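(* Let $\underline{C}$ be a $G$-coalgebra. The functors $F:\mathcal{M}^{G,\underline{C}}\to\mathcal{M}^{C_e}$, $F(\underline{M})=M_e$, and $\mathsf{G}:\mathcal{M}^{C_e}\to\mathcal{M}^{G,\underline{C}}$, $\mathsf{G}(N)=(N\square_{C_e}C_\alpha)_{\alpha\in G}$, form a pair of adjoint functors $(F,\mathsf{G})$ ($F$ left adjoint to $\mathsf{G}$).
   Context: $k$ is a field, $\otimes=\otimes_k$, $G$ is a group with identity $e$; the identity map of an object $X$ is denoted $X$. A $G$-coalgebra (group coalgebra) $\underline{C}=(C_\alpha)_{\alpha\in G}$ is a family of $k$-vector spaces with $k$-linear maps $\Delta_{\alpha,\beta}:C_{\alpha\beta}\to C_\alpha\otimes C_\beta$ ($\alpha,\beta\in G$) and $\varepsilon:C_e\to k$ such that $(\Delta_{\alpha,\beta}\otimes C_\gamma)\circ\Delta_{\alpha\beta,\gamma}=(C_\alpha\otimes\Delta_{\beta,\gamma})\circ\Delta_{\alpha,\beta\gamma}$ and $(C_\alpha\otimes\varepsilon)\circ\Delta_{\alpha,e}=C_\alpha=(\varepsilon\otimes C_\alpha)\circ\Delta_{e,\alpha}$. Then $C_e$ is a coalgebra, and each $C_\alpha$ is a left $C_e$-comodule via $\Delta_{e,\alpha}$. A right $G$-$\underline{C}$-comodule is a family $\underline{M}=(M_\alpha)_{\alpha\in G}$ of $k$-vector spaces with $k$-linear maps $\rho_{\alpha,\beta}:M_{\alpha\beta}\to M_\alpha\otimes C_\beta$ such that $(M_\alpha\otimes\varepsilon)\circ\rho_{\alpha,e}=M_\alpha$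 and $(\rho_{\alpha,\beta}\otimes C_\gamma)\circ\rho_{\alpha\beta,\gamma}=(M_\alpha\otimes\Delta_{\beta,\gamma})\circ\rho_{\alpha,\beta\gamma}$. Morphisms $\underline{M}\to\underline{N}$ are families of $k$-linear maps $\varphi_\alpha:M_\alpha\to N_\alpha$ with $(\varphi_\alpha\otimes C_\beta)\circ\rho^{\underline{M}}_{\alpha,\beta}=\rho^{\underline{N}}_{\alpha,\beta}\circ\varphi_{\alpha\beta}$. This category is $\mathcal{M}^{G,\underline{C}}$. $\mathcal{M}^{C_e}$ is the category of right $C_e$-comodules. $M_e$ is a right $C_e$-comodule via $\rho_{e,e}$. $\square_{C_e}$ is the cotensor product over $C_e$, and the structure maps of $\mathsf{G}(N)$ are $N\square_{C_e}\Delta_{\alpha,\beta}:N\square_{C_e}C_{\alpha\beta}\to N\square_{C_e}(C_\alpha\otimes C_\beta)\cong(N\square_{C_e}C_\alpha)\otimes C_\beta$. (The paper denotes the functor $\mathsf{G}$ by $G$.) *)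

(* Defs.v *)
From HB Require Import structures.
From mathcomp Require Import all_boot all_algebra.
From mathcomp Require Import boolp classical_sets.

Set Implicit Arguments.
Unset Strict Implicit.
Unset Printing Implicit Defensive.

Import GRing.Theory.
Local Open Scope ring_scope.
Local Open Scope quotient_scope.

Lemma linear_ext (k : fieldType) (U V : lmodType k) (f g : {linear U -> V}) :
  (forall x, f x = g x) -> f = g.
Proof.
case: f g => [f [[Hf] [Hf']]] [g [[Hg] [Hg']]] /= /funext fg.
rewrite {}fg in Hf Hf' *.
by rewrite (Prop_irrelevance Hf Hg) (Prop_irrelevance Hf' Hg').
Qed.

(* Elements of U ⊗ V are finite lists of pairs (u, v), read as formal sums,
   modulo the congruence generated by commutativity and bilinearity. *)
Section TensorDef.
Variables (k : fieldType) (U V : lmodType k).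

Inductive tens_eq : seq (U * V) -> seq (U * V) -> Prop :=
| TensRefl s : tens_eq s s
| TensSym s t : tens_eq s t -> tens_eq t s
| TensTrans s t r : tens_eq s t -> tens_eq t r -> tens_eq s r
| TensCat s s' t t' :
    tens_eq s s' -> tens_eq t t' -> tens_eq (s ++ t) (s' ++ t')
| TensComm s t : tens_eq (s ++ t) (t ++ s)
| TensZero v : tens_eq [:: (0, v)] [::]
| TensAddl u u' v : tens_eq [:: (u + u', v)] [:: (u, v); (u', v)]
| TensAddr u v v' : tens_eq [:: (u, v + v')] [:: (u, v); (u, v')]
| TensScale a u v : tens_eq [:: (a *: u, v)] [:: (u, a *: v)].

Definition tens_eqb : rel (seq (U * V)) := fun s t => `[< tens_eq s t >].

Lemma tens_eqb_equiv : equiv_class_of tens_eqb.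
Proof.
split=> [s|s t|t s r]; first by apply/asboolP; exact: TensRefl.
- by apply/asboolP/asboolP; exact: TensSym.
- by move=> /asboolP st /asboolP tr; apply/asboolP; exact: TensTrans st tr.
Qed.

Canonical tens_eqb_equiv_rel := EquivRelPack tens_eqb_equiv.
Canonical tens_eqb_encModRel := defaultEncModRel tens_eqb.

Definition tensor_type : Type := {eq_quot tens_eqb}.

HB.instance Definition _ : EqQuotient _ tens_eqb tensor_type :=
  EqQuotient.on tensor_type.
HB.instance Definition _ := Choice.on tensor_type.

Definition tens_class (s : seq (U * V)) : tensor_type := \pi_tensor_type s.

Lemma tens_classP s t : tens_eq s t -> tens_class s = tens_class t.
Proof. by move=> st; apply/eqP; rewrite piE; apply/asboolP. Qed.

Lemma tens_classE s t : tens_class s = tens_class t -> tens_eq s t.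
Proof. by move/eqP; rewrite piE => /asboolP. Qed.

Lemma tens_reprK (x : tensor_type) : tens_class (repr x) = x.
Proof. exact: reprK. Qed.

Definition tens_add (x y : tensor_type) := tens_class (repr x ++ repr y).
Definition tens_scale (a : k) (x : tensor_type) :=
  tens_class [seq (a *: p.1, p.2) | p <- repr x].

Lemma tens_addE s t :
  tens_add (tens_class s) (tens_class t) = tens_class (s ++ t).
Proof. by apply/tens_classP/TensCat; apply/tens_classE; exact: tens_reprK. Qed.

Lemma tens_eq_scale a s t : tens_eq s t ->
  tens_eq [seq (a *: p.1, p.2) | p <- s] [seq (a *: p.1, p.2) | p <- t].
Proof.
elim=> {s t} [s|s t _|s t r _ + _|s s' t t' _ + _|s t|v|u u' v|u v v'|b u v] /=.
- exact: TensRefl.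
- exact: TensSym.
- exact: TensTrans.
- by rewrite !map_cat; exact: TensCat.
- by rewrite !map_cat; exact: TensComm.
- by rewrite scaler0; exact: TensZero.
- by rewrite scalerDr; exact: TensAddl.
- exact: TensAddr.
- by rewrite scalerA mulrC -scalerA; exact: TensScale.
Qed.

Lemma tens_scaleE a s :
  tens_scale a (tens_class s) = tens_class [seq (a *: p.1, p.2) | p <- s].
Proof. by apply/tens_classP/tens_eq_scale/tens_classE; exact: tens_reprK. Qed.

Lemma tens_classW (P : tensor_type -> Prop) :
  (forall s, P (tens_class s)) -> forall x, P x.
Proof. by move=> Ps x; rewrite -(tens_reprK x). Qed.

Fact tens_addA : associative tens_add.
Proof.
elim/tens_classW=> s; elim/tens_classW=> t; elim/tens_classW=> r.
by rewrite !tens_addE catA.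
Qed.

Fact tens_addC : commutative tens_add.
Proof.
elim/tens_classW=> s; elim/tens_classW=> t; rewrite !tens_addE.
exact/tens_classP/TensComm.
Qed.

Fact tens_add0 : left_id (tens_class [::]) tens_add.
Proof. by elim/tens_classW=> s; rewrite tens_addE. Qed.

Fact tens_scale0 x : tens_scale 0 x = tens_class [::].
Proof.
elim/tens_classW: x => s; rewrite tens_scaleE; apply: tens_classP.
elim: s => [|[u v] s IHs] /=; first exact: TensRefl.
by rewrite scale0r; exact: TensCat (TensZero v) IHs.
Qed.

Fact tens_scaleDl x a b :
  tens_scale (a + b) x = tens_add (tens_scale a x) (tens_scale b x).
Proof.
elim/tens_classW: x => s; rewrite !tens_scaleE tens_addE; apply: tens_classP.
elim: s => [|[u v] s IHs] /=; first exact: TensRefl.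
rewrite scalerDl.
apply: TensTrans (TensCat (TensAddl _ _ _) IHs) _ => /=.
rewrite -cat1s -[in X in tens_eq _ X]cat1s; apply: TensCat (TensRefl _) _.
rewrite -cat1s catA -[in X in tens_eq _ X]cat1s catA.
exact: TensCat (TensComm _ _) (TensRefl _).
Qed.

Fact tens_scale1 : left_id 1 tens_scale.
Proof.
elim/tens_classW=> s; rewrite tens_scaleE; congr tens_class.
by elim: s => [|[u v] s IHs] //=; rewrite scale1r IHs.
Qed.

Fact tens_addN : left_inverse (tens_class [::]) (tens_scale (-1)) tens_add.
Proof.
by move=> x; rewrite -{2}(tens_scale1 x) -tens_scaleDl addNr tens_scale0.
Qed.

HB.instance Definition _ :=
  GRing.isZmodule.Build tensor_type tens_addA tens_addC tens_add0 tens_addN.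

Fact tens_scaleA a b x :
  tens_scale a (tens_scale b x) = tens_scale (a * b) x.
Proof.
elim/tens_classW: x => s; rewrite !tens_scaleE -map_comp; congr tens_class.
by apply: eq_map => p /=; rewrite scalerA.
Qed.

Fact tens_scaleDr : right_distributive tens_scale +%R.
Proof.
move=> a; elim/tens_classW=> s; elim/tens_classW=> t.
by rewrite [_ + _ in LHS]tens_addE !tens_scaleE [RHS]tens_addE map_cat.
Qed.

HB.instance Definition _ := GRing.Zmodule_isLmodule.Build k tensor_type
  tens_scaleA tens_scale1 tens_scaleDr tens_scaleDl.

Definition tensor : lmodType k := tensor_type.

Definition tens (u : U) (v : V) : tensor := tens_class [:: (u, v)].

End TensorDef.

Notation "U ⊗ V" := (tensor U V) (at level 40, left associativity) : type_scope.
Notation "u ⊗t v" := (tens u v) (at level 40, left associativity) : ring_scope.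

Definition bilin (k : fieldType) (U V W : lmodType k) (f : U -> V -> W) :=
  (forall v, linear (f^~ v)) /\ (forall u, linear (f u)).

Section TensorTheory.
Variables (k : fieldType) (U V : lmodType k).
Implicit Types (u : U) (v : V).

Lemma tens_class_lin a (s t : seq (U * V)) :
  a *: tens_class s + tens_class t =
  tens_class ([seq (a *: p.1, p.2) | p <- s] ++ t).
Proof. by rewrite -tens_addE -tens_scaleE. Qed.

Lemma tens_bilin : bilin (@tens k U V).
Proof.
split=> [v a u u'|u a v v']; apply: etrans (esym (tens_class_lin _ _ _)).
- exact/tens_classP/TensAddl.
- apply/tens_classP; apply: TensTrans (TensAddr _ _ _) _.
  exact: TensCat (TensSym (TensScale _ _ _)) (TensRefl _).
Qed.

Lemma tens_classS u v s : tens_class ((u, v) :: s) = u ⊗t v + tens_class s.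
Proof. by rewrite [RHS]tens_addE. Qed.

Lemma tens_ind (P : U ⊗ V -> Prop) : P 0 ->
  (forall u v x, P x -> P (u ⊗t v + x)) -> forall x, P x.
Proof.
move=> P0 PD; elim/tens_classW; elim=> // -[u v] s /(PD u v).
by rewrite tens_classS.
Qed.

Lemma eq_tens_linear (W : lmodType k) (f g : {linear U ⊗ V -> W}) :
  (forall u v, f (u ⊗t v) = g (u ⊗t v)) -> forall x, f x = g x.
Proof.
by move=> fg; elim/tens_ind => [|u v x fgx]; rewrite ?linear0 // !linearD fg fgx.
Qed.

Section Lift.
Variables (W : lmodType k) (f : U -> V -> W) (fB : bilin f).

Definition tens_lift_fun (x : tensor_type U V) : W :=
  \sum_(p <- repr x) f p.1 p.2.

Lemma tens_lift_class s :
  tens_lift_fun (tens_class s) = \sum_(p <- s) f p.1 p.2.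
Proof.
rewrite /tens_lift_fun; move: (tens_classE (tens_reprK (tens_class s))).
move: (repr _) => t; case: fB => fl fr.
have fE1 v a u u' : f (a *: u + u') v = a *: f u v + f u' v by exact: fl.
have fE2 u a v v' : f u (a *: v + v') = a *: f u v + f u v' by exact: fr.
elim=> {s t} [|s t _ ->|s t r _ -> _|s s' t t' _ IH1 _ IH2|s t|v|u u' v|u v v'|a u v] //.
- by rewrite !big_cat IH1 IH2.
- by rewrite !big_cat /= addrC.
- have := fE1 v (-1) 0 0; rewrite big_seq1 big_nil /= scaler0 addr0.
  by rewrite scaleN1r addNr.
- by have := fE1 v 1 u u'; rewrite !big_cons big_nil !addr0 !scale1r.
- by have := fE2 u 1 v v'; rewrite !big_cons big_nil !addr0 !scale1r.
- have f0 : f 0 v = 0.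
    by have := fE1 v (-1) 0 0; rewrite scaler0 addr0 scaleN1r addNr.
  have f0' : f u 0 = 0.
    by have := fE2 u (-1) 0 0; rewrite scaler0 addr0 scaleN1r addNr.
  rewrite !big_cons big_nil !addr0 /=.
  by have := fE1 v a u 0; have := fE2 u a v 0; rewrite f0 f0' !addr0 => -> ->.
Qed.

Lemma tens_lift_linear : linear tens_lift_fun.
Proof.
move=> a; elim/tens_classW=> s; elim/tens_classW=> t.
rewrite tens_class_lin !tens_lift_class big_cat /=; congr (_ + _).
rewrite big_map scaler_sumr; apply: eq_bigr => -[u v] _ /=.
case: fB => fl _; have f0 : f 0 v = 0.
  by have := fl v (-1) 0 0; rewrite /= scaler0 addr0 scaleN1r addNr.
by have := fl v a u 0; rewrite /= f0 !addr0.
Qed.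

(* Universal property; opaque, so that the quotient is never unfolded. *)
Lemma tens_lift_sig : {g : {linear U ⊗ V -> W} | forall u v, g (u ⊗t v) = f u v}.
Proof.
pose fL := GRing.isLinear.Build k (U ⊗ V) W *:%R tens_lift_fun tens_lift_linear.
pose g : {linear U ⊗ V -> W} := HB.pack tens_lift_fun fL.
by exists g => u v; rewrite [LHS]tens_lift_class big_seq1.
Qed.

Definition tens_lift : {linear U ⊗ V -> W} := sval tens_lift_sig.

Lemma tens_liftE u v : tens_lift (u ⊗t v) = f u v.
Proof. exact: (svalP tens_lift_sig). Qed.

End Lift.

End TensorTheory.


Section TensorMaps.
Variable k : fieldType.
Implicit Types U V W X Y : lmodType k.

Definition lid V : {linear V -> V} := idfun.
Definition lcomp U V W (f : {linear V -> W}) (g : {linear U -> V}) :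
  {linear U -> W} := f \o g.

Lemma tensDl U V (u u' : U) (v : V) : (u + u') ⊗t v = u ⊗t v + u' ⊗t v.
Proof. by have := (tens_bilin U V).1 v 1 u u'; rewrite /= !scale1r. Qed.
Lemma tensDr U V (u : U) (v v' : V) : u ⊗t (v + v') = u ⊗t v + u ⊗t v'.
Proof. by have := (tens_bilin U V).2 u 1 v v'; rewrite !scale1r. Qed.
Lemma tens0l U V (v : V) : (0 : U) ⊗t v = 0.
Proof.
by apply: (addrI ((0 : U) ⊗t v)); rewrite -tensDl !addr0.
Qed.
Lemma tens0r U V (u : U) : u ⊗t (0 : V) = 0.
Proof.
by apply: (addrI (u ⊗t (0 : V))); rewrite -tensDr !addr0.
Qed.
Lemma tensZl U V a (u : U) (v : V) : (a *: u) ⊗t v = a *: (u ⊗t v).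
Proof.
by have := (tens_bilin U V).1 v a u 0; rewrite /= !addr0 tens0l addr0.
Qed.
Lemma tensZr U V a (u : U) (v : V) : u ⊗t (a *: v) = a *: (u ⊗t v).
Proof.
by have := (tens_bilin U V).2 u a v 0; rewrite !addr0 tens0r addr0.
Qed.

Fact tmap_bilin U U' V V' (f : {linear U -> U'}) (g : {linear V -> V'}) :
  bilin (fun u v => f u ⊗t g v).
Proof.
by split=> [v a u u'|u a v v'] /=; rewrite linearP ?tensDl ?tensZl ?tensDr ?tensZr.
Qed.

Definition tmap U U' V V' (f : {linear U -> U'}) (g : {linear V -> V'}) :
  {linear U ⊗ V -> U' ⊗ V'} := tens_lift (tmap_bilin f g).

Lemma tmapE U U' V V' (f : {linear U -> U'}) (g : {linear V -> V'}) u v :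
  tmap f g (u ⊗t v) = f u ⊗t g v.
Proof. exact: tens_liftE. Qed.

Fact tassoc_bilin1 U V W (w : W) :
  bilin (fun (u : U) (v : V) => u ⊗t (v ⊗t w)).
Proof.
by split=> [v a u u'|u a v v'] /=; rewrite ?tensDl ?tensZl ?tensDr ?tensZr.
Qed.

Fact tassoc_bilin U V W :
  bilin (fun (x : U ⊗ V) (w : W) => tens_lift (tassoc_bilin1 U V w) x).
Proof.
split=> [w a x x'|x a w w'] /=; first by rewrite linearP.
elim/tens_ind: x => [|u v x IHx]; first by rewrite !linear0 addr0.
rewrite !linearD IHx !tens_liftE !tensDr !tensZr.
by rewrite -!addrA; congr (_ + _); rewrite addrCA.
Qed.

Definition tassoc U V W : {linear (U ⊗ V) ⊗ W -> U ⊗ (V ⊗ W)} :=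
  tens_lift (tassoc_bilin U V W).

Lemma tassocE U V W (u : U) (v : V) (w : W) :
  tassoc U V W ((u ⊗t v) ⊗t w) = u ⊗t (v ⊗t w).
Proof. by rewrite /tassoc !tens_liftE. Qed.

Fact tassoc_inv_bilin1 U V W (u : U) :
  bilin (fun (v : V) (w : W) => (u ⊗t v) ⊗t w).
Proof.
by split=> [w a v v'|v a w w'] /=; rewrite ?(tensDr, tensZr, tensDl, tensZl).
Qed.

Fact tassoc_inv_bilin U V W :
  bilin (fun (u : U) (x : V ⊗ W) => tens_lift (tassoc_inv_bilin1 V W u) x).
Proof.
split=> [x a u u'|u a x x'] /=; last by rewrite linearP.
elim/tens_ind: x => [|v w x IHx]; first by rewrite !linear0 addr0.
rewrite !linearD IHx !tens_liftE !tensDl !tensZl.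
by rewrite -!addrA; congr (_ + _); rewrite addrCA.
Qed.

Definition tassoc_inv U V W : {linear U ⊗ (V ⊗ W) -> (U ⊗ V) ⊗ W} :=
  tens_lift (tassoc_inv_bilin U V W).

Lemma tassoc_invE U V W (u : U) (v : V) (w : W) :
  tassoc_inv U V W (u ⊗t (v ⊗t w)) = (u ⊗t v) ⊗t w.
Proof. by rewrite /tassoc_inv !tens_liftE. Qed.

Fact tunitr_bilin U : bilin (fun (u : U) (c : k^o) => c *: u).
Proof.
split=> [c a u u'|u a c c'] /=; first by rewrite scalerDr !scalerA mulrC.
by rewrite scalerDl scalerA.
Qed.

Definition tunitr U : {linear U ⊗ k^o -> U} := tens_lift (tunitr_bilin U).

Lemma tunitrE U (u : U) (c : k^o) : tunitr U (u ⊗t c) = c *: u.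
Proof. exact: tens_liftE. Qed.

Fact tunitl_bilin U : bilin (fun (c : k^o) (u : U) => c *: u).
Proof. by case: (tunitr_bilin U). Qed.

Definition tunitl U : {linear k^o ⊗ U -> U} := tens_lift (tunitl_bilin U).

Lemma tunitlE U (u : U) (c : k^o) : tunitl U (c ⊗t u) = c *: u.
Proof. exact: tens_liftE. Qed.

Lemma eq_tens3_linear U V W X (f g : {linear (U ⊗ V) ⊗ W -> X}) :
  (forall u v w, f ((u ⊗t v) ⊗t w) = g ((u ⊗t v) ⊗t w)) ->
  forall x, f x = g x.
Proof.
move=> fg; apply: eq_tens_linear => x w.
elim/tens_ind: x => [|u v x IHx]; first by rewrite tens0l !linear0.
by rewrite tensDl !linearD fg IHx.
Qed.

Lemma eq_tens4_linear U V W X Y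
    (f g : {linear ((U ⊗ V) ⊗ W) ⊗ X -> Y}) :
  (forall u v w x,
     f (((u ⊗t v) ⊗t w) ⊗t x) = g (((u ⊗t v) ⊗t w) ⊗t x)) ->
  forall x, f x = g x.
Proof.
move=> fg; apply: eq_tens3_linear => x w y.
elim/tens_ind: x => [|u v x IHx]; first by rewrite !tens0l !linear0.
by rewrite !tensDl !linearD fg IHx.
Qed.

Lemma tmap_comp U U' U2 V V' V2 (f : {linear U' -> U2}) (f' : {linear U -> U'})
    (g : {linear V' -> V2}) (g' : {linear V -> V'}) x :
  tmap f g (tmap f' g' x) = tmap (lcomp f f') (lcomp g g') x.
Proof.
apply: (eq_tens_linear (f := lcomp (tmap f g) (tmap f' g'))) => u v.
by rewrite /= !tmapE.
Qed.

Lemma eq_tmap U U' V V' (f f' : {linear U -> U'}) (g g' : {linear V -> V'}) x :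
  (forall u, f u = f' u) -> (forall v, g v = g' v) -> tmap f g x = tmap f' g' x.
Proof. by move=> /linear_ext -> /linear_ext ->. Qed.

Lemma tmap_id U V x : tmap (lid U) (lid V) x = x.
Proof.
by apply: (eq_tens_linear (g := lid (U ⊗ V))) => u v; rewrite tmapE.
Qed.

Lemma lid_tens U V : lid (U ⊗ V) = tmap (lid U) (lid V).
Proof. by apply: linear_ext => x; rewrite tmap_id. Qed.

Lemma tassoc_nat U U' V V' W W' (f : {linear U -> U'}) (g : {linear V -> V'})
    (h : {linear W -> W'}) x :
  tassoc _ _ _ (tmap (tmap f g) h x) = tmap f (tmap g h) (tassoc _ _ _ x).
Proof.
apply: (eq_tens3_linear (f := lcomp (tassoc _ _ _) (tmap (tmap f g) h))
          (g := lcomp (tmap f (tmap g h)) (tassoc _ _ _))) => u v w.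
by rewrite /= !(tassocE, tmapE).
Qed.

Lemma tassoc_pentagon U V W X x :
  tassoc U V (W ⊗ X) (tassoc (U ⊗ V) W X x) =
  tmap (lid U) (tassoc V W X)
    (tassoc U (V ⊗ W) X (tmap (tassoc U V W) (lid X) x)).
Proof.
apply: (eq_tens4_linear
  (f := lcomp (tassoc U V (W ⊗ X)) (tassoc (U ⊗ V) W X))
  (g := lcomp (tmap (lid U) (tassoc V W X))
      (lcomp (tassoc U (V ⊗ W) X) (tmap (tassoc U V W) (lid X))))) => u v w y.
by rewrite /= !(tassocE, tmapE).
Qed.

Lemma tassocK U V W : cancel (tassoc U V W) (tassoc_inv U V W).
Proof.
apply: (eq_tens3_linear (f := lcomp (tassoc_inv U V W) (tassoc U V W))
          (g := lid _)) => u v w.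
by rewrite /= tassocE tassoc_invE.
Qed.

Lemma tassoc_invK U V W : cancel (tassoc_inv U V W) (tassoc U V W).
Proof.
apply: (eq_tens_linear (f := lcomp (tassoc U V W) (tassoc_inv U V W))
          (g := lid _)) => u x /=.
elim/tens_ind: x => [|v w x IHx]; first by rewrite tens0r !linear0.
by rewrite tensDr !linearD IHx tassoc_invE tassocE.
Qed.

Lemma tunitr_nat U V (f : {linear U -> V}) x :
  tunitr V (tmap f (lid k^o) x) = f (tunitr U x).
Proof.
apply: (eq_tens_linear (f := lcomp (tunitr V) (tmap f (lid k^o)))
         (g := lcomp f (tunitr U))) => u c.
by rewrite /= tmapE !tunitrE linearZ.
Qed.

Lemma tassoc_tunitr U V x :
  tmap (lid U) (tunitr V) (tassoc U V k^o x) = tunitr (U ⊗ V) x.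
Proof.
apply: (eq_tens3_linear (f := lcomp (tmap (lid U) (tunitr V)) (tassoc U V k^o))
         (g := tunitr _)) => u v c.
by rewrite /= tassocE tmapE !tunitrE tensZr.
Qed.

Lemma tassoc_tunitl U V x :
  tunitl (U ⊗ V) (tassoc k^o U V x) = tmap (tunitl U) (lid V) x.
Proof.
apply: (eq_tens3_linear (f := lcomp (tunitl (U ⊗ V)) (tassoc k^o U V))
         (g := tmap (tunitl U) (lid V))) => c u v.
by rewrite /= tassocE tmapE !tunitlE tensZl.
Qed.

End TensorMaps.

Arguments tassoc {k U V W}.
Arguments tassoc_inv {k U V W}.
Arguments tunitr {k U}.
Arguments tunitl {k U}.

Section Exactness.
Variable k : fieldType.

Lemma subspace_projection (V : lmodType k) (P : V -> Prop) :
    P 0 -> (forall a u v, P u -> P v -> P (a *: u + v)) ->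
  exists p : {linear V -> V}, (forall v, P (p v)) /\ (forall v, P v -> p v = v).
Proof.
move=> P0 Plin.
have PZ a u : P u -> P (a *: u) by move=> Pu; rewrite -[_ *: _]addr0; exact: Plin.
have PD u v : P u -> P v -> P (u + v) by rewrite -{2}[u]scale1r; exact: Plin.
have PN u : P u -> P (- u) by rewrite -scaleN1r; exact: PZ.
pose Q (A : set (V * V)) :=
  (forall a u w u' w', A (u, w) -> A (u', w') -> A (a *: u + u', a *: w + w')) /\
  (forall u w, A (u, w) -> P w /\ (P u -> w = u)).
have [F FQ Ftot|A [[Alin AP] Amax]] := @Zorn_bigcup (V * V)%type Q.
  split=> [a u w u' w' [X FX Xu] [Y FY Yu]|u w [X FX]].
    have [XY|YX] := Ftot _ _ FX FY.
      by exists Y => //; apply: (FQ _ FY).1 => //; exact: XY.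
    by exists X => //; apply: (FQ _ FX).1 => //; exact: YX.
  by move=> Xu; apply: (FQ _ FX).2.
have Aext (B : set (V * V)) : (A `<=` B)%classic -> Q B -> (B `<=` A)%classic.
  by move=> AB QB; apply: contrapT => nBA; apply: (Amax B).
have Adiag v : P v -> A (v, v).
  pose B : set (V * V) := fun x => exists u w v,
    [/\ A (u, w) \/ (u, w) = (0, 0), P v & x = (u + v, w + v)].
  have BA : (B `<=` A)%classic.
    apply: Aext => [[u w] Au|].
      by exists u, w, 0; split; [left | | rewrite !addr0].
    split=> [a _ _ _ _ [u [w [t [Auw Pt [-> ->]]]]]
                       [u' [w' [t' [Auw' Pt' [-> ->]]]]]|_ _ [u [w [t [Auw Pt [-> ->]]]]]].
      exists (a *: u + u'), (a *: w + w'), (a *: t + t'); split.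
      - case: Auw => [Auw|[-> ->]]; last by rewrite scaler0 !add0r.
        case: Auw' => [Auw'|[-> ->]]; first by left; exact: Alin.
        left; rewrite !addr0.
        have A0 : A (0, 0).
          by have := Alin (-1) _ _ _ _ Auw Auw; rewrite !scaleN1r !addNr.
        by have := Alin a _ _ _ _ Auw A0; rewrite !addr0.
      - exact: Plin.
      - by rewrite !scalerDr [in LHS]addrACA [in X in _ = (_, X)]addrACA.
    case: Auw => [/AP [Pw Pu]|[-> ->]]; last by rewrite !add0r.
    split; first exact: PD.
    move=> /PD /(_ (PN _ Pt)); rewrite addrK => /Pu -> //.
  by move=> Pv; apply: BA; exists 0, 0, v; split; [right | | rewrite add0r].
have A0 : A (0, 0) by exact: Adiag.
have AZ a u w : A (u, w) -> A (a *: u, a *: w).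
  by move=> Au; have := Alin a _ _ _ _ Au A0; rewrite !addr0.
have AD u w u' w' : A (u, w) -> A (u', w') -> A (u + u', w + w').
  by move=> Au Au'; have := Alin 1 _ _ _ _ Au Au'; rewrite !scale1r.
have Atot y : exists w, A (y, w).
  apply: contrapT => ny; pose B : set (V * V) := fun x => exists a u w,
    A (u, w) /\ x = (a *: y + u, w).
  have BA : (B `<=` A)%classic.
    apply: Aext => [[u w] Au|]; first by exists 0, u, w; rewrite scale0r add0r.
    split=> [b _ _ _ _ [a [u [w [Au [-> ->]]]]] [a' [u' [w' [Au' [-> ->]]]]]
            |_ _ [a [u [w [Au [-> ->]]]]]].
      exists (b * a + a'), (b *: u + u'), (b *: w + w'); split; first exact: Alin.
      by rewrite scalerDr scalerDl scalerA addrACA.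
    have [Pw Pu] := AP _ _ Au; split=> // Pau.
    have [a0|a_neq0] := eqVneq a 0.
      by move: Pau; rewrite a0 scale0r add0r.
    case: ny; exists (a^-1 *: ((a *: y + u) - w)).
    have := AZ a^-1 _ _ (AD _ _ _ _ (Adiag _ Pau) (AZ (-1) _ _ Au)).
    by rewrite !scaleN1r addrK scalerA mulVf // scale1r.
  by apply: ny; exists 0; apply: BA; exists 1, 0, 0; rewrite scale1r addr0.
have [p pP] := choice Atot.
have Auniq u w w' : A (u, w) -> A (u, w') -> w = w'.
  move=> Au /(AZ (-1)) /(AD _ _ _ _ Au); rewrite !scaleN1r subrr => /AP [_ /(_ P0)].
  by move/eqP; rewrite subr_eq0 => /eqP.
have plin : linear p by move=> a u v; apply: Auniq (pP _) _; exact: Alin.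
pose pL := GRing.isLinear.Build k V V *:%R p plin.
pose pl : {linear V -> V} := HB.pack p pL.
exists pl; split=> v; first exact: (AP _ _ (pP v)).1.
exact: (AP _ _ (pP v)).2.
Qed.

Lemma linear_ginv (U V : lmodType k) (f : {linear U -> V}) :
  exists g : {linear V -> U}, forall u, f (g (f u)) = f u.
Proof.
have [|a u v|p [pker pid]] := @subspace_projection U (fun u => f u = 0).
- exact: linear0.
- by rewrite linearP => -> ->; rewrite scaler0 addr0.
have [|a _ _ [u <-] [v <-]|q [qim qid]] :=
    @subspace_projection V (fun v => exists u, f u = v).
- by exists 0; exact: linear0.
- by exists (a *: u + v); rewrite linearP.
have [h hq] := choice qim.
have glin : linear (fun v => h v - p (h v)).
  move=> a u v; set d := h (a *: u + v) - (a *: h u + h v).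
  have pd : p d = d.
    by apply: pid; rewrite linearB linearP /= !hq linearP subrr.
  rewrite -[h _](subrK (a *: h u + h v)) -/d linearD pd linearP.
  by rewrite opprD addrACA subrr add0r scalerBr opprD addrACA.
pose gL := GRing.isLinear.Build k V U *:%R (fun v => h v - p (h v)) glin.
pose g : {linear V -> U} := HB.pack (fun v => h v - p (h v)) gL.
exists g => u; rewrite /= linearB pker subr0 hq.
by apply: qid; exists u.
Qed.

Lemma tmap_inj (U V W : lmodType k) (f : {linear U -> V}) :
  injective f -> injective (tmap f (lid W)).
Proof.
move=> finj; have [g fgf] := linear_ginv f.
have gf u : g (f u) = u by apply: finj.
apply: (can_inj (g := tmap g (lid W))) => x; rewrite tmap_comp.
by rewrite (eq_tmap (f' := lid U) (g' := lid W)) ?tmap_id.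
Qed.

Lemma tmap_ker (U V V' W : lmodType k) (i : {linear U -> V})
    (f : {linear V -> V'}) (x : V ⊗ W) :
    (forall v, f v = 0 -> exists u, i u = v) ->
  tmap f (lid W) x = 0 -> exists y, tmap i (lid W) y = x.
Proof.
move=> ker_f fx0; have [g fgf] := linear_ginv f; have [h ihi] := linear_ginv i.
pose e : {linear V -> V} := lid V \- (g \o f).
have ex : tmap e (lid W) x = x.
  suff E y : tmap e (lid W) y = y - tmap g (lid W) (tmap f (lid W) y).
    by rewrite E fx0 linear0 subr0.
  apply: (eq_tens_linear
    (g := lid _ \- lcomp (tmap g (lid W)) (tmap f (lid W)))) => v w.
  by rewrite /= !tmapE tensDl -scaleN1r tensZl scaleN1r.
exists (tmap h (lid W) (tmap e (lid W) x)); rewrite -[RHS]ex !tmap_comp.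
apply: eq_tmap => // v.
have [|u iu] := ker_f (e v); first by rewrite /= linearB /= fgf subrr.
by apply: (etrans (congr1 (i \o h) (esym iu))); rewrite /= ihi.
Qed.

End Exactness.

Record category := Category {
  obj :> Type;
  hom : obj -> obj -> Type;
  idc : forall X, hom X X;
  compc : forall X Y Z, hom Y Z -> hom X Y -> hom X Z;
  comp1c : forall X Y (f : hom X Y), compc (idc Y) f = f;
  compc1 : forall X Y (f : hom X Y), compc f (idc X) = f;
  compcA : forall X Y Z T (h : hom Z T) (g : hom Y Z) (f : hom X Y),
    compc h (compc g f) = compc (compc h g) f }.

Record functor (A B : category) := Functor {
  fobj :> A -> B;
  fmap : forall X Y, hom X Y -> hom (fobj X) (fobj Y);
  fmap_id : forall X, fmap (idc X) = idc (fobj X);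
  fmap_comp : forall X Y Z (g : hom Y Z) (f : hom X Y),
    fmap (compc g f) = compc (fmap g) (fmap f) }.

Definition adjoint_pair (A B : category) (F : functor A B) (G : functor B A) :=
  exists Phi : forall (X : A) (Y : B), hom (F X) Y -> hom X (G Y),
    (forall X Y, bijective (Phi X Y)) /\
    (forall X X' Y Y' (f : hom X' X) (g : hom Y Y') (u : hom (F X) Y),
       Phi X' Y' (compc g (compc u (fmap F f))) =
       compc (fmap G g) (compc (Phi X Y u) f)).

Record coalgebra (k : fieldType) := Coalgebra {
  coalg_car :> lmodType k;
  coalg_delta : {linear coalg_car -> coalg_car ⊗ coalg_car};
  coalg_eps : {linear coalg_car -> k^o};
  coalg_coassoc : forall x,
    tassoc (tmap coalg_delta (lid coalg_car) (coalg_delta x)) =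
    tmap (lid coalg_car) coalg_delta (coalg_delta x);
  coalg_counitr : forall x,
    tunitr (tmap (lid coalg_car) coalg_eps (coalg_delta x)) = x;
  coalg_counitl : forall x,
    tunitl (tmap coalg_eps (lid coalg_car) (coalg_delta x)) = x }.

Section Comodules.
Variables (k : fieldType) (D : coalgebra k).

Record rcomod := RComod {
  rcomod_car :> lmodType k;
  rcomod_rho : {linear rcomod_car -> rcomod_car ⊗ D};
  rcomod_coassoc : forall x,
    tassoc (tmap rcomod_rho (lid D) (rcomod_rho x)) =
    tmap (lid rcomod_car) (coalg_delta D) (rcomod_rho x);
  rcomod_counit : forall x,
    tunitr (tmap (lid rcomod_car) (coalg_eps D) (rcomod_rho x)) = x }.

Record rcomod_hom (M N : rcomod) := RComodHom {
  rcomod_hom_fun :> {linear M -> N};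
  rcomod_homP : forall x,
    tmap rcomod_hom_fun (lid D) (rcomod_rho M x) =
    rcomod_rho N (rcomod_hom_fun x) }.

Record lcomod := LComod {
  lcomod_car :> lmodType k;
  lcomod_lam : {linear lcomod_car -> D ⊗ lcomod_car};
  lcomod_coassoc : forall x,
    tassoc (tmap (coalg_delta D) (lid lcomod_car) (lcomod_lam x)) =
    tmap (lid D) lcomod_lam (lcomod_lam x);
  lcomod_counit : forall x,
    tunitl (tmap (coalg_eps D) (lid lcomod_car) (lcomod_lam x)) = x }.

Record lcomod_hom (L L' : lcomod) := LComodHom {
  lcomod_hom_fun :> {linear L -> L'};
  lcomod_homP : forall x,
    tmap (lid D) lcomod_hom_fun (lcomod_lam L x) =
    lcomod_lam L' (lcomod_hom_fun x) }.

Lemma rcomod_hom_ext (M N : rcomod) (f g : rcomod_hom M N) :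
  (forall x, f x = g x) -> f = g.
Proof.
case: f g => [f fP] [g gP] /= /linear_ext fg; rewrite {}fg in fP *.
by rewrite (Prop_irrelevance fP gP).
Qed.

Fact rcomod_idP (M : rcomod) x :
  tmap (lid M) (lid D) (rcomod_rho M x) = rcomod_rho M (lid M x).
Proof. exact: tmap_id. Qed.

Definition rcomod_id M := RComodHom (@rcomod_idP M).

Fact rcomod_compP (M N P : rcomod) (g : rcomod_hom N P) (f : rcomod_hom M N) x :
  tmap (lcomp g f) (lid D) (rcomod_rho M x) = rcomod_rho P (lcomp g f x).
Proof.
rewrite /= -rcomod_homP -rcomod_homP tmap_comp.
exact: eq_tmap.
Qed.

Definition rcomod_comp M N P g f := RComodHom (@rcomod_compP M N P g f).

Definition rcomod_cat : category.
Proof.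
by apply: (@Category rcomod rcomod_hom rcomod_id rcomod_comp) => *;
  apply: rcomod_hom_ext.
Defined.

(* L ⊗ W with the left coaction λ ⊗ W *)
Section LComodTensor.
Variables (L : lcomod) (W : lmodType k).

Definition lcomod_tens_lam : {linear L ⊗ W -> D ⊗ (L ⊗ W)} :=
  lcomp tassoc (tmap (lcomod_lam L) (lid W)).

Fact lcomod_tens_coassoc x :
  tassoc (tmap (coalg_delta D) (lid (L ⊗ W)) (lcomod_tens_lam x)) =
  tmap (lid D) lcomod_tens_lam (lcomod_tens_lam x).
Proof.
rewrite /lcomod_tens_lam /=.
have -> y : tmap (coalg_delta D) (lid (L ⊗ W)) y =
            tmap (coalg_delta D) (tmap (lid L) (lid W)) y.
  by apply: eq_tmap => // z; rewrite tmap_id.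
rewrite -tassoc_nat tassoc_pentagon !tmap_comp.
set y := tmap (lcomp (lcomp _ _) _) _ x.
have -> : y = tmap (tmap (lid D) (lcomod_lam L)) (lid W)
                   (tmap (lcomod_lam L) (lid W) x).
  rewrite tmap_comp; apply: eq_tmap => // l /=; exact: lcomod_coassoc.
rewrite tassoc_nat tmap_comp; exact: eq_tmap.
Qed.

Fact lcomod_tens_counit x :
  tunitl (tmap (coalg_eps D) (lid (L ⊗ W)) (lcomod_tens_lam x)) = x.
Proof.
have -> y : tmap (coalg_eps D) (lid (L ⊗ W)) y =
            tmap (coalg_eps D) (tmap (lid L) (lid W)) y.
  by apply: eq_tmap => // z; rewrite tmap_id.
rewrite /lcomod_tens_lam /= -tassoc_nat tassoc_tunitl !tmap_comp.
rewrite -[RHS]tmap_id; apply: eq_tmap => // l /=; exact: lcomod_counit.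
Qed.

Definition lcomod_tens := LComod lcomod_tens_coassoc lcomod_tens_counit.

End LComodTensor.

Section Cotensor.
Variables (N : rcomod) (L : lcomod).

Definition cotensor_pred : pred (N ⊗ L) := fun t =>
  tassoc (tmap (rcomod_rho N) (lid L) t) == tmap (lid N) (lcomod_lam L) t.

Fact cotensor_submod_closed : submod_closed cotensor_pred.
Proof.
split=> [|a x y /eqP xP /eqP yP]; apply/eqP; first by rewrite !linear0.
by rewrite !linearP /= -[in RHS]xP -[in RHS]yP.
Qed.

HB.instance Definition _ :=
  GRing.isSubmodClosed.Build k (N ⊗ L) cotensor_pred cotensor_submod_closed.

(* the equalizer of ρ_N ⊗ L and N ⊗ λ_L *)
Record cotensor_type : Type := Cotensor {
  cotensor_val : N ⊗ L;
  cotensorP : cotensor_val \in cotensor_pred }.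

HB.instance Definition _ := [isSub of cotensor_type for cotensor_val].
HB.instance Definition _ := [Choice of cotensor_type by <:].
HB.instance Definition _ := [SubChoice_isSubLmodule of cotensor_type by <:].

Definition cotensor : lmodType k := cotensor_type.

Definition cotensor_incl : {linear cotensor -> N ⊗ L} :=
  (val : cotensor_type -> N ⊗ L).

Lemma cotensor_inclP (x : cotensor) :
  tassoc (tmap (rcomod_rho N) (lid L) (cotensor_incl x)) =
  tmap (lid N) (lcomod_lam L) (cotensor_incl x).
Proof. exact/eqP/(cotensorP x). Qed.

Lemma cotensor_incl_inj : injective cotensor_incl.
Proof. exact: val_inj. Qed.

Section Corestrict.
Variables (W : lmodType k) (f : {linear W -> N ⊗ L}).
Hypothesis fP : forall x,
  tassoc (tmap (rcomod_rho N) (lid L) (f x)) = tmap (lid N) (lcomod_lam L) (f x).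

Definition cotensor_corestr_fun (x : W) : cotensor :=
  Cotensor (introT eqP (fP x) : f x \in cotensor_pred).

Fact cotensor_corestr_linear : linear cotensor_corestr_fun.
Proof. by move=> a x y; apply: val_inj; rewrite /= linearP. Qed.

HB.instance Definition _ := GRing.isLinear.Build k W cotensor *:%R
  cotensor_corestr_fun cotensor_corestr_linear.

Definition cotensor_corestr : {linear W -> cotensor} := cotensor_corestr_fun.

Lemma cotensor_corestrE x : cotensor_incl (cotensor_corestr x) = f x.
Proof. by []. Qed.

End Corestrict.
End Cotensor.

Arguments cotensor_incl {N L}.

(* cotensor_mapr N f is N □ f, cotensor_mapl L g is g □ L *)
Section CotensorMaps.

Fact cotensor_mapr_subproof (N : rcomod) (L L' : lcomod) (f : lcomod_hom L L')
    (x : cotensor N L) (y := tmap (lid N) f (cotensor_incl x)) :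
  tassoc (tmap (rcomod_rho N) (lid L') y) = tmap (lid N) (lcomod_lam L') y.
Proof.
rewrite {}/y; set y := cotensor_incl x.
have -> : tmap (rcomod_rho N) (lid L') (tmap (lid N) f y) =
          tmap (tmap (lid N) (lid D)) f (tmap (rcomod_rho N) (lid L) y).
  by rewrite !tmap_comp; apply: eq_tmap => // z /=; rewrite tmap_id.
rewrite tassoc_nat cotensor_inclP !tmap_comp; apply: eq_tmap => // z.
exact: lcomod_homP.
Qed.

Definition cotensor_mapr N L L' (f : lcomod_hom L L') :
  {linear cotensor N L -> cotensor N L'} :=
  cotensor_corestr (f := lcomp (tmap (lid N) f) cotensor_incl)
    (cotensor_mapr_subproof f).

Fact cotensor_mapl_subproof (N N' : rcomod) (L : lcomod) (g : rcomod_hom N N')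
    (x : cotensor N L) (y := tmap g (lid L) (cotensor_incl x)) :
  tassoc (tmap (rcomod_rho N') (lid L) y) = tmap (lid N') (lcomod_lam L) y.
Proof.
rewrite {}/y; set y := cotensor_incl x.
have -> : tmap (rcomod_rho N') (lid L) (tmap g (lid L) y) =
          tmap (tmap g (lid D)) (lid L) (tmap (rcomod_rho N) (lid L) y).
  by rewrite !tmap_comp; apply: eq_tmap => // z /=; rewrite rcomod_homP.
rewrite tassoc_nat cotensor_inclP !tmap_comp; apply: eq_tmap => // z /=.
exact: tmap_id.
Qed.

Definition cotensor_mapl N N' L (g : rcomod_hom N N') :
  {linear cotensor N L -> cotensor N' L} :=
  cotensor_corestr (f := lcomp (tmap g (lid L)) cotensor_incl)
    (cotensor_mapl_subproof g).

End CotensorMaps.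

(* The canonical isomorphism (N □ L) ⊗ W ≅ N □ (L ⊗ W); it is bijective
   because - ⊗ W is exact over a field. *)
Section CotensorTensor.
Variables (N : rcomod) (L : lcomod) (W : lmodType k).

Fact cotensor_tens_subproof (x : cotensor N L ⊗ W)
    (y := tassoc (tmap cotensor_incl (lid W) x)) :
  tassoc (tmap (rcomod_rho N) (lid (lcomod_tens L W)) y) =
  tmap (lid N) (lcomod_lam (lcomod_tens L W)) y.
Proof.
rewrite {}/y.
have -> y : tmap (rcomod_rho N) (lid (lcomod_tens L W)) y =
            tmap (rcomod_rho N) (tmap (lid L) (lid W)) y.
  by apply: eq_tmap => // z; rewrite tmap_id.
rewrite -tassoc_nat tassoc_pentagon !tmap_comp.
set y := tmap (lcomp _ _) _ x.
have -> : y = tmap (tmap (lid N) (lcomod_lam L)) (lid W)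
                   (tmap cotensor_incl (lid W) x).
  by rewrite tmap_comp; apply: eq_tmap => // z; exact: cotensor_inclP.
by rewrite tassoc_nat tmap_comp; exact: eq_tmap.
Qed.

Definition cotensor_tens :
    {linear cotensor N L ⊗ W -> cotensor N (lcomod_tens L W)} :=
  cotensor_corestr (L := lcomod_tens L W)
    (f := lcomp tassoc (tmap cotensor_incl (lid W)))
    cotensor_tens_subproof.

Lemma cotensor_tens_inj : injective cotensor_tens.
Proof.
move=> x y /(congr1 (@cotensor_incl _ _)) /= xy.
apply: (tmap_inj (W := W) (@cotensor_incl_inj N L)).
exact: (can_inj (@tassocK _ _ _ _)).
Qed.

Lemma cotensor_tens_surj y : exists x, cotensor_tens x == y.
Proof.
pose f : {linear N ⊗ L -> N ⊗ (D ⊗ L)} :=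
  lcomp tassoc (tmap (rcomod_rho N) (lid L)) \- tmap (lid N) (lcomod_lam L).
pose t := tassoc_inv (cotensor_incl y).
have tE : tassoc t = cotensor_incl y by exact: tassoc_invK.
have fE z : tmap f (lid W) z =
    tmap (lcomp tassoc (tmap (rcomod_rho N) (lid L))) (lid W) z -
    tmap (tmap (lid N) (lcomod_lam L)) (lid W) z.
  apply: (eq_tens_linear (g := tmap _ _ \- tmap _ _)) => u w /=.
  by rewrite !tmapE /= tensDl -scaleN1r tensZl scaleN1r.
have ft0 : tmap f (lid W) t = 0.
  rewrite fE; apply/eqP; rewrite subr_eq0; apply/eqP.
  have assoc_inj : injective
      (lcomp (tmap (lid N) (@tassoc k D L W)) (@tassoc k N (D ⊗ L) W)).
    apply: inj_comp (can_inj (@tassocK _ _ _ _)).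
    apply: (can_inj (g := tmap (lid N) tassoc_inv)) => z.
    rewrite tmap_comp -[RHS]tmap_id; apply: eq_tmap => // u; exact: tassocK.
  apply: assoc_inj => /=.
  have -> : tmap (lcomp tassoc (tmap (rcomod_rho N) (lid L))) (lid W) t =
      tmap tassoc (lid W) (tmap (tmap (rcomod_rho N) (lid L)) (lid W) t).
    by rewrite tmap_comp; exact: eq_tmap.
  rewrite -tassoc_pentagon !tassoc_nat tE.
  have -> : tmap (rcomod_rho N) (tmap (lid L) (lid W)) (cotensor_incl y) =
            tmap (rcomod_rho N) (lid (lcomod_tens L W)) (cotensor_incl y).
    by apply: eq_tmap => // z; rewrite tmap_id.
  by apply: (etrans (cotensor_inclP y)); rewrite tmap_comp; exact: eq_tmap.
have [v|x xt] := tmap_ker (i := cotensor_incl) (f := f) _ ft0.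
  move=> /eqP; rewrite /= subr_eq0 => vP.
  by exists (Cotensor (vP : v \in @cotensor_pred N L)).
exists x; apply/eqP/cotensor_incl_inj.
by rewrite cotensor_corestrE /= xt.
Qed.

Definition cotensor_tens_inv_fun (y : cotensor N (lcomod_tens L W)) :
  cotensor N L ⊗ W := xchoose (cotensor_tens_surj y).

Lemma cotensor_tens_inv_funK y : cotensor_tens (cotensor_tens_inv_fun y) = y.
Proof. exact/eqP/(xchooseP (cotensor_tens_surj y)). Qed.

Fact cotensor_tens_inv_linear : linear cotensor_tens_inv_fun.
Proof.
move=> a x y; apply: cotensor_tens_inj.
by rewrite linearP !cotensor_tens_inv_funK.
Qed.

HB.instance Definition _ := GRing.isLinear.Build k _ _ *:%R
  cotensor_tens_inv_fun cotensor_tens_inv_linear.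

Definition cotensor_tens_inv :
    {linear cotensor N (lcomod_tens L W) -> cotensor N L ⊗ W} :=
  cotensor_tens_inv_fun.

Lemma cotensor_tens_invK : cancel cotensor_tens_inv cotensor_tens.
Proof. exact: cotensor_tens_inv_funK. Qed.

Lemma cotensor_tensK : cancel cotensor_tens cotensor_tens_inv.
Proof. by move=> x; apply: cotensor_tens_inj; rewrite cotensor_tens_invK. Qed.

End CotensorTensor.
End Comodules.

Arguments cotensor_incl {k D N L}.

Section GroupCoalgebras.
Variables (k : fieldType) (G : groupType).

(* C (a * (b * c)) and C (a * b * c), or C a and C (a * 1), are not
   convertible, so the axioms below transport along equalities of indices. *)
Definition transp (M : G -> lmodType k) (a b : G) (ab : a = b) :
  {linear M a -> M b} :=
  match ab in _ = b' return {linear M a -> M b'} with erefl => lid (M a) end.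

Record gcoalgebra := GCoalgebra {
  gcoalg_car :> G -> lmodType k;
  gcoalg_delta : forall a b,
    {linear gcoalg_car (a * b)%g -> gcoalg_car a ⊗ gcoalg_car b};
  gcoalg_eps : {linear gcoalg_car 1%g -> k^o};
  gcoalg_coassoc : forall a b c (x : gcoalg_car (a * b * c)%g),
    tassoc (tmap (gcoalg_delta a b) (lid (gcoalg_car c))
              (gcoalg_delta (a * b)%g c x)) =
    tmap (lid (gcoalg_car a)) (gcoalg_delta b c)
      (gcoalg_delta a (b * c)%g (transp gcoalg_car (esym (mulgA a b c)) x));
  gcoalg_counitr : forall a (x : gcoalg_car a),
    tunitr (tmap (lid (gcoalg_car a)) gcoalg_eps
      (gcoalg_delta a 1%g (transp gcoalg_car (esym (mulg1 a)) x))) = x;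
  gcoalg_counitl : forall a (x : gcoalg_car a),
    tunitl (tmap gcoalg_eps (lid (gcoalg_car a))
      (gcoalg_delta 1%g a (transp gcoalg_car (esym (mul1g a)) x))) = x }.

Variable C : gcoalgebra.

Record gcomod := GComod {
  gcomod_car :> G -> lmodType k;
  gcomod_rho : forall a b,
    {linear gcomod_car (a * b)%g -> gcomod_car a ⊗ C b};
  gcomod_counit : forall a (x : gcomod_car a),
    tunitr (tmap (lid (gcomod_car a)) (gcoalg_eps C)
      (gcomod_rho a 1%g (transp gcomod_car (esym (mulg1 a)) x))) = x;
  gcomod_coassoc : forall a b c (x : gcomod_car (a * b * c)%g),
    tassoc (tmap (gcomod_rho a b) (lid (C c)) (gcomod_rho (a * b)%g c x)) =
    tmap (lid (gcomod_car a)) (gcoalg_delta C b c)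
      (gcomod_rho a (b * c)%g (transp gcomod_car (esym (mulgA a b c)) x)) }.

Record gcomod_hom (M N : gcomod) := GComodHom {
  gcomod_hom_fun :> forall a, {linear M a -> N a};
  gcomod_homP : forall a b (x : M (a * b)%g),
    tmap (gcomod_hom_fun a) (lid (C b)) (gcomod_rho M a b x) =
    gcomod_rho N a b (gcomod_hom_fun (a * b)%g x) }.

Lemma gcomod_hom_ext (M N : gcomod) (f g : gcomod_hom M N) :
  (forall a x, f a x = g a x) -> f = g.
Proof.
case: f g => [f fP] [g gP] /= fg.
have {}fg : f = g by apply: functional_extensionality_dep => a; exact: (linear_ext (fg a)).
by rewrite {}fg in fP *; rewrite (Prop_irrelevance fP gP).
Qed.

Fact gcomod_idP (M : gcomod) a b (x : M (a * b)%g) :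
  tmap (lid (M a)) (lid (C b)) (gcomod_rho M a b x) =
  gcomod_rho M a b (lid (M (a * b)%g) x).
Proof. exact: tmap_id. Qed.

Definition gcomod_id M : gcomod_hom M M :=
  GComodHom (gcomod_hom_fun := fun a => lid (M a)) (@gcomod_idP M).

Fact gcomod_compP (M N P : gcomod) (g : gcomod_hom N P) (f : gcomod_hom M N)
    a b (x : M (a * b)%g) :
  tmap (lcomp (g a) (f a)) (lid (C b)) (gcomod_rho M a b x) =
  gcomod_rho P a b (lcomp (g (a * b)%g) (f (a * b)%g) x).
Proof. by rewrite /= -!gcomod_homP tmap_comp; exact: eq_tmap. Qed.

Definition gcomod_comp M N P (g : gcomod_hom N P) (f : gcomod_hom M N) :
  gcomod_hom M P :=
  GComodHom (gcomod_hom_fun := fun a => lcomp (g a) (f a)) (gcomod_compP g f).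

Definition gcomod_cat : category.
Proof.
by apply: (@Category gcomod gcomod_hom gcomod_id gcomod_comp) => *;
  apply: gcomod_hom_ext.
Defined.

(* Δ_{a,b} and ρ_{a,b} on a component whose index is only provably a * b *)
Definition gcoalg_delta_at (a b c : G) (cab : c = (a * b)%g) :
  {linear C c -> C a ⊗ C b} := lcomp (gcoalg_delta C a b) (transp C cab).

Definition gcomod_rho_at (M : gcomod) (a b c : G) (cab : c = (a * b)%g) :
  {linear M c -> M a ⊗ C b} := lcomp (gcomod_rho M a b) (transp M cab).

Lemma gcoalg_delta_at_id a b (e : (a * b)%g = (a * b)%g) :
  gcoalg_delta_at e = gcoalg_delta C a b.
Proof. by rewrite (eq_irrelevance e erefl); exact: linear_ext. Qed.

Lemma gcomod_rho_at_id (M : gcomod) a b (e : (a * b)%g = (a * b)%g) :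
  gcomod_rho_at M e = gcomod_rho M a b.
Proof. by rewrite (eq_irrelevance e erefl); exact: linear_ext. Qed.

Lemma gcoalg_coassoc_at a b c ab bc abc (e1 : abc = (ab * c)%g)
    (e2 : ab = (a * b)%g) (e3 : abc = (a * bc)%g) (e4 : bc = (b * c)%g) x :
  tassoc (tmap (gcoalg_delta_at e2) (lid (C c)) (gcoalg_delta_at e1 x)) =
  tmap (lid (C a)) (gcoalg_delta_at e4) (gcoalg_delta_at e3 x).
Proof.
subst ab bc; move: e3 x; subst abc => e3 x; 
rewrite (eq_irrelevance e3 (esym (mulgA a b c))) !gcoalg_delta_at_id.
exact: gcoalg_coassoc.
Qed.

Lemma gcoalg_counitr_at a (e : a = (a * 1)%g) x :
  tunitr (tmap (lid (C a)) (gcoalg_eps C) (gcoalg_delta_at e x)) = x.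
Proof. by rewrite (eq_irrelevance e (esym (mulg1 a))) gcoalg_counitr. Qed.

Lemma gcoalg_counitl_at a (e : a = (1 * a)%g) x :
  tunitl (tmap (gcoalg_eps C) (lid (C a)) (gcoalg_delta_at e x)) = x.
Proof. by rewrite (eq_irrelevance e (esym (mul1g a))) gcoalg_counitl. Qed.

Lemma gcomod_coassoc_at (M : gcomod) a b c ab bc abc (e1 : abc = (ab * c)%g)
    (e2 : ab = (a * b)%g) (e3 : abc = (a * bc)%g) (e4 : bc = (b * c)%g) x :
  tassoc (tmap (gcomod_rho_at M e2) (lid (C c)) (gcomod_rho_at M e1 x)) =
  tmap (lid (M a)) (gcoalg_delta_at e4) (gcomod_rho_at M e3 x).
Proof.
subst ab bc; move: e3 x; subst abc => e3 x; 
rewrite (eq_irrelevance e3 (esym (mulgA a b c))) !gcomod_rho_at_id.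
rewrite gcoalg_delta_at_id; exact: gcomod_coassoc.
Qed.

Lemma gcomod_counit_at (M : gcomod) a (e : a = (a * 1)%g) x :
  tunitr (tmap (lid (M a)) (gcoalg_eps C) (gcomod_rho_at M e x)) = x.
Proof. by rewrite (eq_irrelevance e (esym (mulg1 a))) gcomod_counit. Qed.

Lemma gcomod_homP_at (M N : gcomod) (f : gcomod_hom M N) a b c
    (e : c = (a * b)%g) x :
  tmap (f a) (lid (C b)) (gcomod_rho_at M e x) = gcomod_rho_at N e (f c x).
Proof. by subst c; rewrite !gcomod_rho_at_id gcomod_homP. Qed.

(* the coalgebra C_e *)
Definition gcoalg_one : coalgebra k :=
  Coalgebra (fun x => gcoalg_coassoc_at _ _ _ _ x)
    (gcoalg_counitr_at (esym (mulg1 1%g)))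
    (fun x => gcoalg_counitl_at _ x).

(* C_a as a left C_e-comodule, via Δ_{e,a} *)
Definition gcoalg_lcomod (a : G) : lcomod gcoalg_one :=
  @LComod k gcoalg_one (C a) (gcoalg_delta_at (esym (mul1g a)))
    (fun x => gcoalg_coassoc_at _ _ _ _ x) (fun x => gcoalg_counitl_at _ x).

(* M_e as a right C_e-comodule, via ρ_{e,e} *)
Definition gcomod_one (M : gcomod) : rcomod gcoalg_one :=
  @RComod k gcoalg_one (M 1%g) (gcomod_rho_at M (esym (mulg1 1%g)))
    (fun x => gcomod_coassoc_at _ _ _ _ x) (fun x => gcomod_counit_at _ x).

Definition gcomod_hom_one (M N : gcomod) (f : gcomod_hom M N) :
  rcomod_hom (gcomod_one M) (gcomod_one N) :=
  @RComodHom k gcoalg_one (gcomod_one M) (gcomod_one N) (f 1%g)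
    (fun x => gcomod_homP_at f _ x).

(* M ↦ M_e *)
Definition functor_one : functor gcomod_cat (rcomod_cat gcoalg_one).
Proof.
by apply: (@Functor gcomod_cat (rcomod_cat gcoalg_one) gcomod_one gcomod_hom_one)
  => *; apply: rcomod_hom_ext.
Defined.

Fact gcoalg_delta_colin_subproof (a b : G) x :
  tmap (lid gcoalg_one) (gcoalg_delta C a b)
    (lcomod_lam (gcoalg_lcomod (a * b)%g) x) =
  lcomod_lam (lcomod_tens (gcoalg_lcomod a) (C b)) (gcoalg_delta C a b x).
Proof.
rewrite /= -(gcoalg_delta_at_id erefl).
exact: (esym (gcoalg_coassoc_at _ _ _ _ x)).
Qed.

Definition gcoalg_delta_colin (a b : G) :
    lcomod_hom (gcoalg_lcomod (a * b)%g) (lcomod_tens (gcoalg_lcomod a) (C b)) :=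
  @LComodHom k gcoalg_one (gcoalg_lcomod (a * b)%g)
    (lcomod_tens (gcoalg_lcomod a) (C b)) (gcoalg_delta C a b)
    (@gcoalg_delta_colin_subproof a b).

Section CotensorComodule.
Variable N : rcomod gcoalg_one.

(* N □ Δ_{a,b} followed by N □ (C_a ⊗ C_b) ≅ (N □ C_a) ⊗ C_b *)
Definition cotensor_rho (a b : G) :
    {linear cotensor N (gcoalg_lcomod (a * b)%g) ->
            cotensor N (gcoalg_lcomod a) ⊗ C b} :=
  lcomp (cotensor_tens_inv N (gcoalg_lcomod a) (C b))
    (cotensor_mapr N (gcoalg_delta_colin a b)).

Lemma cotensor_rhoE a b x :
  tassoc (tmap cotensor_incl (lid (C b)) (cotensor_rho a b x)) =
  tmap (lid N) (gcoalg_delta C a b) (cotensor_incl x).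
Proof.
have := cotensor_tens_invK (cotensor_mapr N (gcoalg_delta_colin a b) x).
by move/(congr1 cotensor_incl); rewrite !cotensor_corestrE.
Qed.

Lemma cotensor_incl_transp a b (e : a = b) x :
  cotensor_incl (transp (fun a => cotensor N (gcoalg_lcomod a)) e x) =
  tmap (lid N) (transp C e) (cotensor_incl x).
Proof. by case: b / e; rewrite tmap_id. Qed.

Fact cotensor_gcounit a (x : cotensor N (gcoalg_lcomod a)) :
  tunitr (tmap (lid _) (gcoalg_eps C) (cotensor_rho a 1%g
    (transp (fun a => cotensor N (gcoalg_lcomod a)) (esym (mulg1 a)) x))) = x.
Proof.
apply: cotensor_incl_inj; rewrite -tunitr_nat.
set y := transp _ _ x.
have -> : tmap cotensor_incl (lid k^o)
            (tmap (lid _) (gcoalg_eps C) (cotensor_rho a 1%g y)) =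
          tmap (tmap (lid N) (lid (C a))) (gcoalg_eps C)
            (tmap cotensor_incl (lid (C 1%g)) (cotensor_rho a 1%g y)).
  by rewrite !tmap_comp; apply: eq_tmap => // z; rewrite [RHS]tmap_id.
rewrite -tassoc_tunitr tassoc_nat cotensor_rhoE cotensor_incl_transp !tmap_comp.
rewrite -[RHS]tmap_id; apply: eq_tmap => // z; exact: gcoalg_counitr.
Qed.

Fact cotensor_gcoassoc a b c (x : cotensor N (gcoalg_lcomod (a * b * c)%g)) :
  tassoc (tmap (cotensor_rho a b) (lid (C c)) (cotensor_rho (a * b)%g c x)) =
  tmap (lid _) (gcoalg_delta C b c)
    (cotensor_rho a (b * c)%g
      (transp (fun a => cotensor N (gcoalg_lcomod a)) (esym (mulgA a b c)) x)).
Proof.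
set y := transp _ _ x.
apply: (tmap_inj (W := C b ⊗ C c) (@cotensor_incl_inj _ _ _ _)).
apply: (can_inj (@tassocK _ _ _ _)).
have -> : tmap cotensor_incl (lid (C b ⊗ C c)) (tmap (lid _) (gcoalg_delta C b c)
            (cotensor_rho a (b * c)%g y)) =
          tmap (tmap (lid N) (lid (C a))) (gcoalg_delta C b c)
            (tmap cotensor_incl (lid (C (b * c)%g)) (cotensor_rho a (b * c)%g y)).
  by rewrite !tmap_comp; apply: eq_tmap => // z; rewrite [RHS]tmap_id.
rewrite tassoc_nat cotensor_rhoE cotensor_incl_transp lid_tens -tassoc_nat.
rewrite tassoc_pentagon !tmap_comp.
set t := tmap _ _ (cotensor_rho _ _ _).
have -> : t = tmap (tmap (lid N) (gcoalg_delta C a b)) (lid (C c))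
    (tmap cotensor_incl (lid (C c)) (cotensor_rho (a * b)%g c x)).
  by rewrite tmap_comp; apply: eq_tmap => // z; exact: cotensor_rhoE.
rewrite tassoc_nat cotensor_rhoE !tmap_comp; apply: eq_tmap => // z.
exact: gcoalg_coassoc.
Qed.

Definition cotensor_gcomod : gcomod :=
  @GComod (fun a => cotensor N (gcoalg_lcomod a)) cotensor_rho
    cotensor_gcounit cotensor_gcoassoc.

End CotensorComodule.

Fact cotensor_gcomod_homP (N N' : rcomod gcoalg_one) (f : rcomod_hom N N')
    a b x :
  tmap (cotensor_mapl (gcoalg_lcomod a) f) (lid (C b)) (cotensor_rho N a b x) =
  cotensor_rho N' a b (cotensor_mapl (gcoalg_lcomod (a * b)%g) f x).
Proof.
apply: (tmap_inj (W := C b) (@cotensor_incl_inj _ _ _ _)).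
apply: (can_inj (@tassocK _ _ _ _)).
rewrite cotensor_rhoE cotensor_corestrE /=.
have -> : tmap cotensor_incl (lid (C b)) (tmap (cotensor_mapl (gcoalg_lcomod a) f)
            (lid (C b)) (cotensor_rho N a b x)) =
          tmap (tmap f (lid (C a))) (lid (C b))
            (tmap cotensor_incl (lid (C b)) (cotensor_rho N a b x)).
  by rewrite !tmap_comp; exact: eq_tmap.
by rewrite tassoc_nat cotensor_rhoE !tmap_comp; apply: eq_tmap => // z /=; rewrite tmap_id.
Qed.

Definition cotensor_gcomod_hom (N N' : rcomod gcoalg_one) (f : rcomod_hom N N') :
  gcomod_hom (cotensor_gcomod N) (cotensor_gcomod N') :=
  @GComodHom (cotensor_gcomod N) (cotensor_gcomod N')
    (fun a => cotensor_mapl (gcoalg_lcomod a) f) (cotensor_gcomod_homP f).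

(* N ↦ (N □ C_a)_a *)
Definition functor_cotensor : functor (rcomod_cat gcoalg_one) gcomod_cat.
Proof.
apply: (@Functor (rcomod_cat gcoalg_one) gcomod_cat cotensor_gcomod
         cotensor_gcomod_hom) => [N|N N' N2 g f]; apply: gcomod_hom_ext => a x;
  apply: cotensor_incl_inj; rewrite /= ?tmap_id //.
by rewrite tmap_comp; exact: eq_tmap.
Defined.

End GroupCoalgebras.

(* Main.v *)
Require Import Defs.
From mathcomp Require Import all_boot all_algebra.

Set Implicit Arguments.
Unset Strict Implicit.
Unset Printing Implicit Defensive.

Import GRing.Theory.
Local Open Scope ring_scope.

(** A colinear map [u : M_e -> N] corresponds to the family
    [(u ⊗ C_a) ∘ ρ_{e,a} : M_a -> N ⊗ C_a].  Coassociativity of [M] and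
    colinearity of [u] put its values in the cotensor product [N □ C_a]
    ([cotensor_transpose_inclP]), and coassociativity again makes the family a
    morphism of G-comodules ([cotensor_transpose_homP]).  Naturality in [M]
    holds because morphisms commute with [ρ_{e,a}].

    The way back composes a morphism [f : M -> (N □ C_a)_a], at the index [e],
    with the counit of the adjunction [η = N ⊗ ε : N □ C_e -> N].  The key fact
    is [cotensor_counit_rho]: the coaction [ρ_{e,a}] of [(N □ C_a)_a] followed
    by [η ⊗ C_a] is the inclusion of [N □ C_a] in [N ⊗ C_a], by the counit
    axiom of the G-coalgebra.  On the other hand [ρ_N ∘ η] is the inclusion of
    [N □ C_e] in [N ⊗ C_e] ([rcomod_rho_cotensor_counit]); the case [a = e] of
    the key fact then says that [η] is colinear.  The key fact also gives one
    of the two inversion formulas, because [f] commutes with the coactions: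
    [(η f_e ⊗ C_a) ρ_{e,a} = (η ⊗ C_a) ρ_{e,a} f_a = incl f_a].
    The other one, [η (u ⊗ C_e) ρ_{e,e} = u], is the counit axiom of [M]. *)

(** The triangle identity for the unit object [k]. *)
Lemma tunitr_tunitl (k : fieldType) (U V : lmodType k) (x : (U ⊗ k^o) ⊗ V) :
  tmap tunitr (lid V) x = tmap (lid U) tunitl (tassoc x).
Proof.
apply: (eq_tens3_linear (f := tmap tunitr (lid V))
          (g := lcomp (tmap (lid U) tunitl) tassoc)) => u c v.
by rewrite /= tassocE !tmapE tunitrE tunitlE tensZl tensZr.
Qed.

Section CotensorAdjunction.
Variables (k : fieldType) (G : groupType) (C : gcoalgebra k G).

Section Transpose.
Variables (M : gcomod C) (N : rcomod (gcoalg_one C)).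
Variable u : rcomod_hom (gcomod_one M) N.

Definition cotensor_transpose_incl (a : G) : {linear M a -> N ⊗ C a} :=
  lcomp (tmap u (lid (C a))) (gcomod_rho_at M (esym (mul1g a))).

(** Both sides are [u ⊗ C_e ⊗ C_a] applied to one of the two iterated coactions
    [M_a -> M_e ⊗ C_e ⊗ C_a], which agree by coassociativity; the left-hand
    side has this form because [u] is colinear. *)
Lemma cotensor_transpose_inclP (a : G) (x : M a) :
  tassoc (tmap (rcomod_rho N) (lid (gcoalg_lcomod C a))
    (cotensor_transpose_incl a x)) =
  tmap (lid N) (lcomod_lam (gcoalg_lcomod C a)) (cotensor_transpose_incl a x).
Proof.
pose r := gcomod_rho_at M (esym (mul1g a)) x.
rewrite -[cotensor_transpose_incl a x]/(tmap u (lid (C a)) r).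
have -> : tmap (rcomod_rho N) (lid (C a)) (tmap u (lid (C a)) r) =
          tmap (tmap u (lid (C 1%g))) (lid (C a))
            (tmap (rcomod_rho (gcomod_one M)) (lid (C a)) r).
  by rewrite !tmap_comp; apply: eq_tmap => // z; rewrite /= -rcomod_homP.
rewrite tassoc_nat (gcomod_coassoc_at _ _ (esym (mul1g a)) (esym (mul1g a))).
by rewrite !tmap_comp; apply: eq_tmap => // z; exact: tmap_id.
Qed.

Definition cotensor_transpose_fun (a : G) :
    {linear M a -> cotensor_gcomod N a} :=
  cotensor_corestr (L := gcoalg_lcomod C a) (@cotensor_transpose_inclP a).

(** After the embedding of [(N □ C_a) ⊗ C_b] in [N ⊗ (C_a ⊗ C_b)], both sides
    are [(u ⊗ Δ_{a,b}) ρ_{e,ab}], by coassociativity of [M] at [e, a, b]. *)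
Lemma cotensor_transpose_homP (a b : G) (x : M (a * b)%g) :
  tmap (cotensor_transpose_fun a) (lid (C b)) (gcomod_rho M a b x) =
  gcomod_rho (cotensor_gcomod N) a b (cotensor_transpose_fun (a * b)%g x).
Proof.
apply: (tmap_inj (W := C b) (@cotensor_incl_inj _ _ _ _)).
apply: (can_inj (@tassocK _ _ _ _)).
rewrite [RHS]cotensor_rhoE cotensor_corestrE /=.
have -> : tmap cotensor_incl (lid (C b))
            (tmap (cotensor_transpose_fun a) (lid (C b))
              (gcomod_rho M a b x)) =
          tmap (tmap u (lid (C a))) (lid (C b))
            (tmap (gcomod_rho_at M (esym (mul1g a))) (lid (C b))
              (gcomod_rho_at M erefl x)).
  by rewrite gcomod_rho_at_id !tmap_comp; exact: eq_tmap.
rewrite tassoc_nat (gcomod_coassoc_at _ _ (esym (mul1g (a * b)%g)) erefl).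
rewrite gcoalg_delta_at_id !tmap_comp; apply: eq_tmap => // z; exact: tmap_id.
Qed.

Definition cotensor_transpose : gcomod_hom M (cotensor_gcomod N) :=
  GComodHom cotensor_transpose_homP.

End Transpose.

Section Counit.
Variable N : rcomod (gcoalg_one C).

Definition cotensor_counit_fun : {linear cotensor_gcomod N 1%g -> N} :=
  lcomp tunitr (lcomp (tmap (lid N) (gcoalg_eps C))
    (cotensor_incl (N := N) (L := gcoalg_lcomod C 1%g))).

(** Since the coaction of [N □ C_a] is [N ⊗ Δ_{e,a}], applying [N ⊗ ε ⊗ C_a]
    after it amounts to the left counit axiom [(ε ⊗ C_a) Δ_{e,a} = C_a]. *)
Lemma cotensor_counit_rho (a : G) (x : cotensor_gcomod N a) :
  tmap cotensor_counit_fun (lid (C a))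
    (gcomod_rho_at (cotensor_gcomod N) (esym (mul1g a)) x) = cotensor_incl x.
Proof.
rewrite /gcomod_rho_at [lcomp _ _ _]/=.
set y := transp _ _ x.
have -> : tmap cotensor_counit_fun (lid (C a)) (cotensor_rho N 1%g a y) =
    tmap tunitr (lid (C a))
      (tmap (tmap (lid N) (gcoalg_eps C)) (lid (C a))
        (tmap cotensor_incl (lid (C a)) (cotensor_rho N 1%g a y))).
  by rewrite !tmap_comp; exact: eq_tmap.
rewrite tunitr_tunitl tassoc_nat cotensor_rhoE cotensor_incl_transp !tmap_comp.
rewrite -[RHS]tmap_id; apply: eq_tmap => // z; exact: gcoalg_counitl.
Qed.

(** Contract with [ε] the last factor of the equation
    [(ρ_N ⊗ C_e) t = (N ⊗ Δ) t] that holds in the cotensor product. *)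
Lemma rcomod_rho_cotensor_counit (x : cotensor_gcomod N 1%g) :
  rcomod_rho N (cotensor_counit_fun x) = cotensor_incl x.
Proof.
rewrite /cotensor_counit_fun /= -tunitr_nat.
set t := cotensor_incl x.
have -> : tmap (rcomod_rho N) (lid k^o) (tmap (lid N) (gcoalg_eps C) t) =
          tmap (tmap (lid N) (lid (C 1%g))) (gcoalg_eps C)
            (tmap (rcomod_rho N) (lid (C 1%g)) t).
  by rewrite !tmap_comp; apply: eq_tmap => // z; rewrite [RHS]tmap_id.
rewrite -tassoc_tunitr tassoc_nat (cotensor_inclP x) !tmap_comp.
rewrite -[RHS]tmap_id; apply: eq_tmap => // z; exact: gcoalg_counitr_at.
Qed.

Lemma cotensor_counit_homP (x : gcomod_one (cotensor_gcomod N)) :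
  tmap cotensor_counit_fun (lid (gcoalg_one C))
    (rcomod_rho (gcomod_one (cotensor_gcomod N)) x) =
  rcomod_rho N (cotensor_counit_fun x).
Proof.
rewrite rcomod_rho_cotensor_counit -cotensor_counit_rho /=.
(* The coaction of M_e is indexed by e = e * e read as a right unit law, the
   general lemma by the left unit law. *)
by rewrite (eq_irrelevance (esym (mulg1 1%g)) (esym (mul1g 1%g))).
Qed.

Definition cotensor_counit :
    rcomod_hom (gcomod_one (cotensor_gcomod N)) N :=
  RComodHom cotensor_counit_homP.

End Counit.

Definition cotensor_untranspose (M : gcomod C) (N : rcomod (gcoalg_one C))
    (f : gcomod_hom M (cotensor_gcomod N)) : rcomod_hom (gcomod_one M) N :=
  rcomod_comp (cotensor_counit N) (gcomod_hom_one f).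

Lemma cotensor_transposeK M N :
  cancel (@cotensor_transpose M N) (@cotensor_untranspose M N).
Proof.
move=> u; apply: rcomod_hom_ext => x /=.
rewrite tmap_comp.
have -> y : tmap (lcomp (lid N) u) (lcomp (gcoalg_eps C) (lid _)) y =
    tmap u (lid k^o) (tmap (lid (M 1%g)) (gcoalg_eps C) y).
  by rewrite tmap_comp; exact: eq_tmap.
by rewrite tunitr_nat gcomod_counit_at.
Qed.

Lemma cotensor_untransposeK M N :
  cancel (@cotensor_untranspose M N) (@cotensor_transpose M N).
Proof.
move=> f; apply: gcomod_hom_ext => a x; apply: cotensor_incl_inj.
rewrite -[RHS]cotensor_counit_rho -gcomod_homP_at cotensor_corestrE /=.
by rewrite tmap_comp; exact: eq_tmap.
Qed.

End CotensorAdjunction.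

Theorem proposition1p1 (k : fieldType) (G : groupType) (C : gcoalgebra k G) :
  adjoint_pair (functor_one C) (functor_cotensor C).
Proof.
exists (@cotensor_transpose k G C); split=> [M N|M M' N N' f g u].
  exists (@cotensor_untranspose k G C M N).
    exact: cotensor_transposeK.
  exact: cotensor_untransposeK.
apply: gcomod_hom_ext => a x; apply: cotensor_incl_inj.
have fP := gcomod_homP_at f (esym (mul1g a)) x.
apply: (etrans _ (congr1 (tmap g (lid _) \o tmap u (lid _)) fP)) => /=.
by rewrite !tmap_comp; exact: eq_tmap.
Qed.
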